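(* Let $\Theta\subset\mathbb{R}^d$ be closed, bounded and convex, let $\ell_t=f_t+r$ ($t=1,2,\dots$) be convex Lipschitz losses, and let the standing assumptions listed in the context hold with constants $\sigma,G,M,D_{\max}$. Let $\Phi_t:\Theta\to\Theta$ be dynamical models that are contractive with respect to the Bregman divergence $D$ used in the algorithm, i.e. $$D(\Phi_t(\theta)\|\Phi_t(\theta'))\le D(\theta\|\theta')\qquad\text{for all }\theta,\theta'\in\Theta,\ t=1,\dots,T.$$ Let $\widehat\theta_1,\dots,\widehat\theta_T$ be generated by the Dynamic Mirror Descent (DMD) algorithm (see context) with a non-increasing positive step size sequence, $\eta_{t+1}\le\eta_t$. Then for an arbitrary comparator sequence $\boldsymbol\theta_T=(\theta_1,\dots,\theta_T)\in\Theta^T$, $$\sum_{t=1}^T\ell_t(\widehat\theta_t)-\sum_{t=1}^T\ell_t(\theta_t)\le\frac{D_{\max}}{\eta_{T+1}}+\frac{2M}{\eta_T}V_\Phi(\boldsymbol\theta_T)+\frac{G^2}{2\sigma}\sum_{t=1}^T\eta_t,\qquad V_\Phi(\boldsymbol\theta_T):=\sum_{t=1}^{T-1}\|\theta_{t+1}-\Phi_t(\theta_t)\|.$$ Moreover, if $\eta_t\propto 1/\sqrt t$ or $\eta_t\propto1/\sqrt T$ (with proportionality constant independent of $t$ and $T$), then for some constant $C>0$ independent of $T$, $$\sum_{t=1}^T\ell_t(\widehat\theta_t)-\sum_{t=1}^T\ell_t(\theta_t)\le C\sqrt T\,\bigl(1+V_\Phi(\boldsymbol\theta_T)\bigr).$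$
   Context: Setting. $\Theta\subset\mathbb{R}^d$ is closed, bounded, convex. At each time $t$ the loss is $\ell_t=f_t+r$, with $f_t,r:\Theta\to\mathbb{R}$ convex and $r$ not depending on $t$. Subgradients exist at all points of $\Theta$; $\nabla f_t(\theta),\nabla r(\theta)$ denote (arbitrarily chosen) subgradients and $\nabla\ell_t=\nabla f_t+\nabla r$. Standing assumptions. $\|\cdot\|$ is a norm on $\mathbb{R}^d$ with dual norm $\|\cdot\|_*$. $\psi:\Theta\to\mathbb{R}$ is continuously differentiable and $\sigma$-strongly convex ($\sigma>0$): $\psi(\theta_1)\ge\psi(\theta_2)+\langle\nabla\psi(\theta_2),\theta_1-\theta_2\rangle+\frac\sigma2\|\theta_1-\theta_2\|^2$. The Bregman divergence is $D(\theta_1\|\theta_2)=\psi(\theta_1)-\psi(\theta_2)-\langle\nabla\psi(\theta_2),\theta_1-\theta_2\rangle$. For all $t$ and $\theta\in\Theta$: $\|\nabla\ell_t(\theta)\|_*\le G$ and $\|\nabla\psi(\theta)\|_*\le M$. For all $\theta_1,\theta_2\in\Theta$: $D(\theta_1\|\theta_2)\le D_{\max}$. The constants $\sigma,G,M,D_{\max}$ do not depend on $T$. DMD algorithm. Given a non-increasing sequence of step sizes $\eta_t>0$ and maps $\Phi_t:\Theta\to\Theta$, choose $\widehat\theta_1\in\Theta$ arbitrarily and for $t=1,\dots,T$ set $$\widetilde\theta_{t+1}=\arg\min_{\theta\in\Theta}\ \eta_t\langle\nabla f_t(\widehat\theta_t),\theta\rangle+\eta_t r(\theta)+D(\theta\|\widehat\theta_t),\qquad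 \widehat\theta_{t+1}=\Phi_t(\widetilde\theta_{t+1}).$$ *)

(* Defs.v *)
From HB Require Import structures.
From mathcomp Require Export all_boot all_order all_algebra.
From mathcomp Require Export boolp classical_sets reals ereal topology.
From mathcomp Require Export normedtype landau convex.
Export Order.TTheory GRing.Theory Num.Theory.
Export numFieldNormedType.Exports.

Set Implicit Arguments.
Unset Strict Implicit.
Unset Printing Implicit Defensive.

Local Open Scope classical_set_scope.
Local Open Scope ring_scope.

(* Functions on Theta are represented by total functions on 'rV[R]_d that are
   only ever constrained, and only ever evaluated, at points of Theta. *)

Definition dotp (R : realType) (d : nat) (u v : 'rV[R]_d) : R :=
  \sum_(i < d) u ord0 i * v ord0 i.

(* The built-in norm `|x| on 'rV[R]_d is the sup norm; N is an arbitrary norm.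
   All norms on R^d being equivalent, the library's topological notions
   (closed, bounded_set, lipschitz, little-o) do not depend on that choice. *)
Record is_norm (R : realType) (d : nat) (N : 'rV[R]_d -> R) : Prop := IsNorm {
  is_normD : forall x y, N (x + y) <= N x + N y;
  is_normZ : forall (a : R) x, N (a *: x) = `|a| * N x;
  is_norm0_eq0 : forall x, N x = 0 -> x = 0 }.

Definition dual_norm (R : realType) (d : nat) (N : 'rV[R]_d -> R)
    (u : 'rV[R]_d) : \bar R :=
  ereal_sup [set (dotp u x)%:E | x in [set x | N x <= 1]].

Definition is_subgradient (R : realType) (d : nat) (Theta : set 'rV[R]_d)
    (h : 'rV[R]_d -> R) (x g : 'rV[R]_d) : Prop :=
  forall y, Theta y -> h x + dotp g (y - x) <= h y.

(* Continuous differentiability relative to Theta, with gradient gpsi.  When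
   Theta has empty interior the gradient is not unique: gpsi is one choice. *)
Definition C1_on (R : realType) (d : nat) (Theta : set 'rV[R]_d)
    (psi : 'rV[R]_d -> R) (gpsi : 'rV[R]_d -> 'rV[R]_d) : Prop :=
  (forall x, Theta x -> forall y : 'rV[R]_d,
     (psi y : R^o) = psi x + dotp (gpsi x) (y - x)
               +o_(y \near within Theta (nbhs x)) (y - x)) /\
  {within Theta, continuous gpsi}.

Definition bregman (R : realType) (d : nat) (psi : 'rV[R]_d -> R)
    (gpsi : 'rV[R]_d -> 'rV[R]_d) (x y : 'rV[R]_d) : R :=
  psi x - psi y - dotp (gpsi y) (x - y).

Definition strongly_convex_on (R : realType) (d : nat) (Theta : set 'rV[R]_d)
    (N psi : 'rV[R]_d -> R) (gpsi : 'rV[R]_d -> 'rV[R]_d) (sigma : R) : Prop :=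
  forall x y, Theta x -> Theta y ->
    psi y + dotp (gpsi y) (x - y) + sigma / 2 * N (x - y) ^+ 2 <= psi x.

(* gf and gr are arbitrary subgradient selections; time starts at t = 1. *)
Record admissible_losses (R : realType) (d : nat) (Theta : set 'rV[R]_d)
    (N : 'rV[R]_d -> R) (G : R)
    (f : nat -> 'rV[R]_d -> R) (r : 'rV[R]_d -> R)
    (gf : nat -> 'rV[R]_d -> 'rV[R]_d) (gr : 'rV[R]_d -> 'rV[R]_d) : Prop :=
  AdmissibleLosses {
  loss_convex : forall t, (1 <= t)%N -> convex_function Theta (f t);
  reg_convex : convex_function Theta r;
  loss_lipschitz : forall t, (1 <= t)%N ->
    [lipschitz (f t x + r x : R^o) | x in Theta];
  loss_subgradient : forall t x, (1 <= t)%N -> Theta x ->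
    is_subgradient Theta (f t) x (gf t x);
  reg_subgradient : forall x, Theta x -> is_subgradient Theta r x (gr x);
  loss_gradient_bound : forall t x, (1 <= t)%N -> Theta x ->
    (dual_norm N (gf t x + gr x)%R <= G%:E)%E }.

Definition contractive_model (R : realType) (d : nat) (Theta : set 'rV[R]_d)
    (D : 'rV[R]_d -> 'rV[R]_d -> R) (phi : 'rV[R]_d -> 'rV[R]_d) : Prop :=
  (forall x, Theta x -> Theta (phi x)) /\
  (forall x y, Theta x -> Theta y -> D (phi x) (phi y) <= D x y).

Definition is_argmin (R : realType) (d : nat) (Theta : set 'rV[R]_d)
    (J : 'rV[R]_d -> R) (x : 'rV[R]_d) : Prop :=
  Theta x /\ forall y, Theta y -> J x <= J y.

Definition step_sizes (R : realType) (eta : nat -> R) : Prop :=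
  forall t, (1 <= t)%N -> 0 < eta t /\ eta t.+1 <= eta t.

(* hth is the sequence of predictions, tth that of the intermediate points. *)
Record dmd_iterates (R : realType) (d : nat) (Theta : set 'rV[R]_d)
    (psi : 'rV[R]_d -> R) (gpsi : 'rV[R]_d -> 'rV[R]_d)
    (r : 'rV[R]_d -> R) (gf Phi : nat -> 'rV[R]_d -> 'rV[R]_d)
    (eta : nat -> R) (T : nat) (hth tth : nat -> 'rV[R]_d) : Prop :=
  DmdIterates {
  dmd_init : Theta (hth 1%N);
  dmd_mirror_step : forall t, (1 <= t <= T)%N ->
    is_argmin Theta
      (fun x => eta t * dotp (gf t (hth t)) x + eta t * r x
                + bregman psi gpsi x (hth t))
      (tth t.+1);
  dmd_model_step : forall t, (1 <= t <= T)%N -> hth t.+1 = Phi t (tth t.+1) }.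

Definition regret (R : realType) (d : nat) (f : nat -> 'rV[R]_d -> R)
    (r : 'rV[R]_d -> R) (T : nat) (hth th : nat -> 'rV[R]_d) : R :=
  \sum_(1 <= t < T.+1) (f t (hth t) + r (hth t)) -
  \sum_(1 <= t < T.+1) (f t (th t) + r (th t)).

Definition variation (R : realType) (d : nat) (N : 'rV[R]_d -> R)
    (Phi : nat -> 'rV[R]_d -> 'rV[R]_d) (T : nat) (th : nat -> 'rV[R]_d) : R :=
  \sum_(1 <= t < T) N (th t.+1 - Phi t (th t)).

(* Main.v *)
Require Import Defs.
From mathcomp Require Import unstable interval_inference ring lra.

Set Implicit Arguments.
Unset Strict Implicit.
Unset Printing Implicit Defensive.

Local Open Scope classical_set_scope.
Local Open Scope ring_scope.

(* First-order optimality of the mirror step, the three-point identity and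
   Young's inequality give, for each t,
     l_t(hth_t) - l_t(th_t) <=
       (D(th_t, hth_t) - D(th_t, tth_(t+1))) / eta_t + G^2 eta_t / (2 sigma).
   Contractivity bounds D(Phi_t th_t, hth_(t+1)) by D(th_t, tth_(t+1)), and
   replacing Phi_t th_t by th_(t+1) costs 2 M N(th_(t+1) - Phi_t th_t), because
   x |-> D(x, z) is 2M-Lipschitz for N.  The sum over t then telescopes; the
   increments of 1 / eta_t are absorbed by the bound D <= Dmax. *)

(** * Bilinearity and symmetry of the pairing *)

Section DotProduct.
Variables (R : realType) (d : nat).
Implicit Types (a : R) (u v x y : 'rV[R]_d).

Lemma dotpDr u x y : dotp u (x + y) = dotp u x + dotp u y.
Proof.
by rewrite /dotp -big_split; apply: eq_bigr => i _; rewrite mxE mulrDr.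
Qed.

Lemma dotpZr a u x : dotp u (a *: x) = a * dotp u x.
Proof.
by rewrite /dotp mulr_sumr; apply: eq_bigr => i _; rewrite mxE mulrCA.
Qed.

Lemma dotpC u v : dotp u v = dotp v u.
Proof. by apply: eq_bigr => i _; rewrite mulrC. Qed.

Lemma dotpNr u x : dotp u (- x) = - dotp u x.
Proof. by rewrite -scaleN1r dotpZr mulN1r. Qed.

Lemma dotpDl u v x : dotp (u + v) x = dotp u x + dotp v x.
Proof. by rewrite dotpC dotpDr !(dotpC x). Qed.

Lemma dotpNl u x : dotp (- u) x = - dotp u x.
Proof. by rewrite dotpC dotpNr dotpC. Qed.

End DotProduct.

(** * The norm [N] and its duality inequality *)

Section Norm.
Variables (R : realType) (d : nat) (N : 'rV[R]_d -> R).
Hypothesis hN : is_norm N.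

Lemma is_normr0 : N 0 = 0.
Proof. by rewrite -(scale0r (0 : 'rV[R]_d)) (is_normZ hN) normr0 mul0r. Qed.

Lemma is_normrN x : N (- x) = N x.
Proof. by rewrite -scaleN1r (is_normZ hN) normrN1 mul1r. Qed.

Lemma is_normr_ge0 x : 0 <= N x.
Proof.
have := is_normD hN x (- x); rewrite subrr is_normr0 is_normrN.
by rewrite -mulr2n pmulrn_lge0.
Qed.

Lemma dual_norm_le_ge0 u c : (dual_norm N u <= c%:E)%E -> 0 <= c.
Proof.
move=> uc; rewrite -lee_fin; apply: le_trans uc; apply: ereal_sup_ubound.
exists 0; first by rewrite /= is_normr0 ler01.
by rewrite -(scale0r (0 : 'rV[R]_d)) dotpZr mul0r.
Qed.

(** Rescale [x] to the unit sphere of [N]; if [N x = 0] then [x = 0] and both sides vanish. *)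
Lemma dotp_le_dual_norm u c x :
  (dual_norm N u <= c%:E)%E -> dotp u x <= c * N x.
Proof.
move=> uc; have [Nx0|Nx0] := eqVneq (N x) 0.
  rewrite Nx0 mulr0 (is_norm0_eq0 hN Nx0).
  by rewrite -(scale0r (0 : 'rV[R]_d)) dotpZr mul0r.
have Nx_gt0 : 0 < N x by rewrite lt_neqAle eq_sym Nx0 is_normr_ge0.
rewrite -ler_pdivrMr // mulrC -dotpZr -lee_fin; apply: le_trans uc.
apply: ereal_sup_ubound; exists ((N x)^-1 *: x) => //=.
by rewrite (is_normZ hN) ger0_norm ?invr_ge0 ?is_normr_ge0// mulVf.
Qed.

End Norm.

(** * Convexity along segments and first-order optimality *)

Section Segment.
Variables (R : realType) (d : nat) (Theta : set 'rV[R]_d).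

(** [conv] gives the weight [s] to its first argument, hence the endpoint [y] comes first. *)
Let segmentE (s : {i01 R}) (x y : 'rV[R]_d) :
  x + s%:num *: (y - x) = conv s (y : convex_lmodType 'rV[R]_d) x.
Proof.
rewrite /conv /= /onem scalerBr scalerBl scale1r.
by rewrite addrCA.
Qed.

Lemma convex_set_segment x y (s : R) : convex_set Theta ->
  Theta x -> Theta y -> 0 <= s <= 1 -> Theta (x + s *: (y - x)).
Proof.
move=> cT Tx Ty s01; have -> : s = (Itv01 (andP s01).1 (andP s01).2)%:num by [].
by rewrite segmentE; apply/set_mem/cT; apply/mem_set.
Qed.

Lemma convex_function_segment (h : 'rV[R]_d -> R) x y (s : R) :
  convex_function Theta h -> Theta x -> Theta y -> 0 <= s <= 1 ->
  h (x + s *: (y - x)) <= h x + s * (h y - h x).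
Proof.
move=> ch Tx Ty s01; have -> : s = (Itv01 (andP s01).1 (andP s01).2)%:num by [].
rewrite segmentE; apply: le_trans (ch _ _ _ _ _) _; [exact/mem_set..|].
rewrite convRE /onem; lra.
Qed.

(** The little-o is relative to [Theta], so only directions staying in [Theta] are allowed. One
    small [s] suffices for the optimality argument; no limit is taken. *)
Lemma C1_on_direction psi gpsi x v e :
  C1_on Theta psi gpsi -> Theta x ->
  (forall s : R, 0 <= s <= 1 -> Theta (x + s *: v)) -> 0 < e ->
  exists s : R, [/\ 0 < s, s <= 1 &
    psi (x + s *: v) <= psi x + s * (dotp (gpsi x) v + e)].
Proof.
move=> [dpsi _] Tx Tv e0.
(* Dividing by [|v| + 1] instead of [|v|] covers [v = 0] as well. *)
have v0 : 0 < `|v| + 1 by rewrite ltr_wpDl.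
have e'0 : 0 < e / (`|v| + 1) by rewrite divr_gt0.
have /= := dpsi x Tx.
set o := the_littleo _ _ _ _ _ => hpsi.
have : \forall y \near within Theta (nbhs x),
    `|o y| <= e / (`|v| + 1) * `|y - x| by apply: littleoP.
rewrite /within /= => /nbhs_ballP[/= del del0 hdel].
pose s : R := Num.min 1 (del / 2 / (`|v| + 1)).
have s0 : 0 < s by rewrite lt_min ltr01 !divr_gt0.
have s1 : s <= 1 by rewrite ge_min lexx.
have s01 : 0 <= s <= 1 by rewrite (ltW s0).
have snv : s * `|v| < del.
  apply: (@le_lt_trans _ _ (s * (`|v| + 1))); first by rewrite ler_pM2l// lerDl.
  apply: (@le_lt_trans _ _ (del / 2)); last by lra.
  by rewrite -ler_pdivlMr// ge_min lexx orbT.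
have /hdel /(_ (Tv s s01)) : ball x del (x + s *: v).
  by rewrite -ball_normE /= opprD addNKr normrN normrZ gtr0_norm.
rewrite [x + _]addrC addrK normrZ (gtr0_norm s0) => ho.
exists s; split => //.
rewrite [psi (x + _)]hpsi [x + _]addrC addrK dotpZr -addrA lerD2l mulrDr lerD2l.
rewrite [_ + x]addrC; apply: le_trans (ler_norm _) _.
rewrite [s *: v + x]addrC in ho; apply: le_trans ho _.
rewrite mulrCA ler_pM2l// mulrAC ler_pdivrMr// ler_pM2l// lerDl.
exact: ler01.
Qed.

(* Only the smooth part psi is differentiated: keeping the increments of the
   possibly nonsmooth h avoids choosing a subgradient of h at z. *)
Lemma argmin_addC1_le (h psi : 'rV[R]_d -> R) gpsi z y :
  convex_set Theta -> convex_function Theta h -> C1_on Theta psi gpsi ->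
  is_argmin Theta (fun x => h x + psi x) z -> Theta y ->
  h z - h y <= dotp (gpsi z) (y - z).
Proof.
move=> cT ch dpsi [Tz zmin] Ty; apply/ler_addgt0Pr => e e0.
have Tv s : 0 <= s <= 1 -> Theta (z + s *: (y - z)).
  exact: convex_set_segment.
have [s [s0 s1 hs]] := C1_on_direction dpsi Tz Tv e0.
have s01 : 0 <= s <= 1 by rewrite (ltW s0).
have := convex_function_segment ch Tz Ty s01.
have := zmin _ (Tv s s01) => h1 h2.
(* Minimality compares [z] with [z + s *: (y - z)]; convexity bounds the increment of [h] and [hs]
   that of [psi]. Both bounds are multiples of [s], which then cancels. *)
have h3 : s * (h z - h y) <= s * (dotp (gpsi z) (y - z) + e) by lra.
by rewrite ler_pM2l in h3.
Qed.

End Segment.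

(** Induction on [T]; the term [- b T] on the right is what the next summand telescopes against. *)
Lemma weighted_telescope_le (R : realType) (eta a b v : nat -> R) (B K : R) (T : nat) :
  (1 <= T)%N -> 0 <= K -> step_sizes eta ->
  (forall t, (1 <= t <= T)%N -> a t <= B) ->
  (forall t, (1 <= t < T)%N -> 0 <= v t /\ a t.+1 <= b t + K * v t) ->
  \sum_(1 <= t < T.+1) (a t - b t) / eta t <=
    (B - b T) / eta T + K / eta T * \sum_(1 <= t < T) v t.
Proof.
move=> T1 K0 heta; case: T T1 => // n _; elim: n => [|n IHn] ha hv.
  have [eta1 _] := heta 1%N isT.
  rewrite big_nat1 big_geq// mulr0 addr0 ler_pM2r ?invr_gt0// lerD2r.
  exact: ha.
rewrite big_nat_recr //= [in leRHS]big_nat_recr //=.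
have [en1 en12] := heta n.+1 isT; have [en2 _] := heta n.+2 isT.
have [v0 hab] := hv n.+1 (leqnn _).
have V0 : 0 <= \sum_(1 <= t < n.+1) v t.
  rewrite big_nat_cond; apply: sumr_ge0 => t /andP[/andP[t1 tn] _].
  by have [] := hv t; rewrite ?t1 //= ltnS ltnW.
have ha' t : (1 <= t <= n.+1)%N -> a t <= B.
  by move=> /andP[t1 tn]; rewrite ha// t1 leqW.
have hv' t : (1 <= t < n.+1)%N -> 0 <= v t /\ a t.+1 <= b t + K * v t.
  by move=> /andP[t1 tn]; apply: hv; rewrite t1 leqW.
apply: le_trans (lerD (IHn ha' hv') (lexx _)) _.
have aB : a n.+2 <= B by apply: ha; rewrite leqnn.
move: (\sum_(1 <= t < n.+1) v t) V0 => V V0.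
have ie : (eta n.+1)^-1 <= (eta n.+2)^-1 by rewrite lef_pV2.
have ie0 : 0 < (eta n.+1)^-1 by rewrite invr_gt0.
move: (eta n.+1)^-1 (eta n.+2)^-1 ie ie0 => p q pq p0.
(* First trade [b n.+1] for [a n.+2]. The new bracket is nonnegative because [a n.+2 <= B], so its
   weight may grow from [p] to [q]. *)
have h1 : (B - b n.+1 + K * V) * p <= (B - a n.+2 + K * (V + v n.+1)) * p.
  by rewrite ler_pM2r//; lra.
have h2 : (B - a n.+2 + K * (V + v n.+1)) * p <=
    (B - a n.+2 + K * (V + v n.+1)) * q.
  by rewrite ler_wpM2l// addr_ge0 ?subr_ge0// mulr_ge0// addr_ge0.
lra.
Qed.

(** * Bregman divergence estimates and the regret bound *)

Section Regret.
Variables (R : realType) (d : nat) (N : 'rV[R]_d -> R) (Theta : set 'rV[R]_d).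
Variables (psi : 'rV[R]_d -> R) (gpsi : 'rV[R]_d -> 'rV[R]_d).
Variables sigma G M Dmax : R.
Hypothesis hN : is_norm N.
Hypothesis Theta_convex : convex_set Theta.
Hypothesis hsigma : 0 < sigma.
Hypothesis hpsi : C1_on Theta psi gpsi.
Hypothesis hsc : strongly_convex_on Theta N psi gpsi sigma.
Hypothesis hM : forall x, Theta x -> (dual_norm N (gpsi x) <= M%:E)%E.
Hypothesis hD : forall x y, Theta x -> Theta y -> bregman psi gpsi x y <= Dmax.
Local Notation D := (bregman psi gpsi).

Lemma bregman_ge x y : Theta x -> Theta y ->
  sigma / 2 * N (x - y) ^+ 2 <= D x y.
Proof. by move=> Tx Ty; have := hsc Tx Ty; rewrite /bregman; lra. Qed.

Lemma bregman_ge0 x y : Theta x -> Theta y -> 0 <= D x y.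
Proof.
move=> Tx Ty; apply: le_trans (bregman_ge Tx Ty).
by rewrite mulr_ge0 ?exprn_ge0 ?(is_normr_ge0 hN)// divr_ge0 ?ltW.
Qed.

Lemma bregman_three_points x y z :
  D x z - D x y - D y z = dotp (gpsi y - gpsi z) (x - y).
Proof.
rewrite /bregman dotpDl dotpNl.
have -> : x - z = (x - y) + (y - z) by rewrite addrA subrK.
rewrite dotpDr; ring.
Qed.

(** By the three-point identity, [D x z - D y z] is the pairing of [gpsi x - gpsi z] with [x - y],
    minus [D y x >= 0]. Each gradient contributes at most [M * N (x - y)]. *)
Lemma bregman_lipschitzl x y z : Theta x -> Theta y -> Theta z ->
  D x z <= D y z + 2 * M * N (x - y).
Proof.
move=> Tx Ty Tz.
have h1 : 0 <= D y x by exact: bregman_ge0.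
have h2 := dotp_le_dual_norm hN (x - y) (hM Tx).
have h3 := dotp_le_dual_norm hN (- (x - y)) (hM Tz).
rewrite (is_normrN hN) dotpNr in h3.
have := bregman_three_points y x z.
rewrite -[y - x]opprB dotpNr dotpDl dotpNl; lra.
Qed.

Section OneStep.
Variables (f : nat -> 'rV[R]_d -> R) (r : 'rV[R]_d -> R).
Variables (gf : nat -> 'rV[R]_d -> 'rV[R]_d) (gr : 'rV[R]_d -> 'rV[R]_d).
Hypothesis hl : admissible_losses Theta N G f r gf gr.

Lemma mirror_step_le t (eta : R) x y z : (1 <= t)%N -> 0 < eta ->
  Theta x -> Theta y ->
  is_argmin Theta (fun u => eta * dotp (gf t x) u + eta * r u + D u x) z ->
  f t x + r x - (f t y + r y) <=
    (D y x - D y z) / eta + G ^+ 2 / (2 * sigma) * eta.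
Proof.
move=> t1 eta0 Tx Ty zmin; have Tz := zmin.1.
(* Up to a constant, the objective is [h + psi]: the part of [D u x] linear in [u] goes into the
   convex term [h]. *)
pose h u := eta * dotp (gf t x) u + eta * r u - dotp (gpsi x) u.
have ch : convex_function Theta h.
  move=> s u v uT vT; have := reg_convex hl s uT vT.
  rewrite !convRE /h /conv /= !dotpDr !dotpZr.
  rewrite -(ler_pM2l eta0); lra.
have hmin : is_argmin Theta (fun u => h u + psi u) z.
  split=> // u Tu; have := zmin.2 u Tu.
  by rewrite /h /bregman !dotpDr !dotpNr; lra.
have {hmin} := argmin_addC1_le Theta_convex ch hpsi hmin Ty.
have := bregman_three_points y z x; rewrite dotpDl dotpNl => h3.
(* [f t] is linearised from [x] to [y], but [r] only from [x] to [z], since optimality already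
   controls [r z - r y]. What remains is the pairing of [gf t x + gr x] with [x - z], which [G]
   bounds. *)
have hf := loss_subgradient hl t1 Tx Ty.
have hr := reg_subgradient hl Tx Tz.
have hG := dotp_le_dual_norm hN (x - z) (loss_gradient_bound hl t1 Tx).
have hzx := bregman_ge Tz Tx.
rewrite -opprB (is_normrN hN) in hzx.
rewrite dotpDl !dotpDr !dotpNr in hG.
rewrite !dotpDr !dotpNr in h3 hf hr.
rewrite /h !dotpDr !dotpNr => hopt.
have {}hG := ler_wpM2l (ltW eta0) hG.
have {}hf := ler_wpM2l (ltW eta0) hf.
have {}hr := ler_wpM2l (ltW eta0) hr.
(* Young's inequality, absorbing the gradient term into the divergence. *)
have young : eta * (G * N (x - z)) <=
    sigma / 2 * N (x - z) ^+ 2 + G ^+ 2 / (2 * sigma) * eta ^+ 2.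
  rewrite -subr_ge0.
  have -> : sigma / 2 * N (x - z) ^+ 2 + G ^+ 2 / (2 * sigma) * eta ^+ 2
      - eta * (G * N (x - z)) = (sigma * N (x - z) - G * eta) ^+ 2 / (2 * sigma).
    by field; rewrite gt_eqF.
  by rewrite divr_ge0 ?sqr_ge0// mulr_ge0 ?ltW.
rewrite -(ler_pM2l eta0) [leRHS]mulrDr.
rewrite [eta * (_ / eta)]mulrC divfK ?gt_eqF//.
rewrite [eta * (_ * eta)]mulrCA -expr2.
lra.
Qed.

Variables (Phi : nat -> 'rV[R]_d -> 'rV[R]_d) (T : nat) (eta : nat -> R).
Variables hth tth th : nat -> 'rV[R]_d.
Hypothesis T_gt0 : (1 <= T)%N.
Hypothesis hPhi : forall t, (1 <= t <= T)%N -> contractive_model Theta D (Phi t).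
Hypothesis heta : step_sizes eta.
Hypothesis hdmd : dmd_iterates Theta psi gpsi r gf Phi eta T hth tth.
Hypothesis hth_mem : forall t, (1 <= t <= T)%N -> Theta (th t).

Lemma dmd_iterate_mem t : (1 <= t <= T.+1)%N -> Theta (hth t).
Proof.
case: t => // -[_|t /= tT]; first exact: dmd_init hdmd.
have /= [tT1 _] := dmd_mirror_step hdmd (t := t.+1) tT.
by rewrite (dmd_model_step hdmd)//; apply: (hPhi (t := t.+1) tT).1.
Qed.

Lemma dmd_regret_le : regret f r T hth th <=
  Dmax / eta T.+1 + 2 * M / eta T * variation N Phi T th
  + G ^+ 2 / (2 * sigma) * \sum_(1 <= t < T.+1) eta t.
Proof.
have M0 : 0 <= M by apply: dual_norm_le_ge0 (hM (dmd_init hdmd)).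
have T1 : (1 <= T <= T)%N by rewrite T_gt0 leqnn.
have [eT eT1] := heta T_gt0; have [eS _] := heta (ltn0Sn T).
rewrite /regret -sumrB.
apply: (@le_trans _ _ (\sum_(1 <= t < T.+1)
  ((D (th t) (hth t) - D (th t) (tth t.+1)) / eta t
   + G ^+ 2 / (2 * sigma) * eta t))).
  rewrite big_nat_cond [leRHS]big_nat_cond.
  apply: ler_sum => t; rewrite andbT ltnS => tT; have /andP[t1 tT'] := tT.
  apply: mirror_step_le => //; first exact: (heta t1).1.
  - by apply: dmd_iterate_mem; rewrite t1 leqW.
  - exact: hth_mem.
  - exact: dmd_mirror_step hdmd _ _.
rewrite big_split -mulr_sumr lerD2r.
have K0 : 0 <= 2 * M by rewrite mulr_ge0.
have ha t : (1 <= t <= T)%N -> D (th t) (hth t) <= Dmax.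
  move=> tT; have /andP[t1 tT'] := tT; apply: hD; first exact: hth_mem.
  by apply: dmd_iterate_mem; rewrite t1 leqW.
have hv t : (1 <= t < T)%N -> 0 <= N (th t.+1 - Phi t (th t)) /\
  D (th t.+1) (hth t.+1) <=
    D (th t) (tth t.+1) + 2 * M * N (th t.+1 - Phi t (th t)).
  move=> /andP[t1 tT]; split; first exact: is_normr_ge0.
  have tT' : (1 <= t <= T)%N by rewrite t1 ltnW.
  have [Phi_mem Phi_contr] := hPhi tT'.
  have [Ttth _] := dmd_mirror_step hdmd tT'.
  have Tth := hth_mem tT'.
  rewrite (dmd_model_step hdmd tT').
  apply: le_trans (bregman_lipschitzl _ (Phi_mem _ Tth) _) _.
  - exact: hth_mem.
  - exact: Phi_mem.
  by rewrite lerD2r Phi_contr.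
apply: le_trans (weighted_telescope_le
  (b := fun t => D (th t) (tth t.+1)) T_gt0 K0 heta ha hv) _.
(* It remains to drop the last divergence and enlarge the weight of [Dmax] to [1 / eta T.+1]; the
   latter uses [0 <= Dmax], which follows from [0 <= D <= Dmax]. *)
rewrite lerD2r mulrBl lerBlDr.
have [TtthT _] := dmd_mirror_step hdmd T1.
have b0 := bregman_ge0 (hth_mem T1) TtthT.
have D0 : 0 <= Dmax := le_trans b0 (hD (hth_mem T1) TtthT).
apply: ler_wpDr; first by rewrite mulr_ge0// invr_ge0 ltW.
by rewrite ler_wpM2l// lef_pV2.
Qed.

End OneStep.
End Regret.

(** With [b ^+ 2 = a ^+ 2 + 1], the induction step [2 * a + b^-1 <= 2 * b] amounts to
    [0 <= (a - b) ^+ 2]. *)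
Lemma sum_inv_sqrt_le (R : realType) (n : nat) :
  \sum_(1 <= t < n.+1) (Num.sqrt t%:R)^-1 <= 2 * Num.sqrt n%:R :> R.
Proof.
elim: n => [|n IHn]; first by rewrite big_geq// sqrtr0 mulr0.
rewrite big_nat_recr//=; apply: le_trans (lerD IHn (lexx _)) _.
set a : R := Num.sqrt n%:R; set b : R := Num.sqrt n.+1%:R.
have a0 : 0 <= a by rewrite sqrtr_ge0.
have b0 : 0 < b by rewrite sqrtr_gt0 ltr0n.
have bb : b ^+ 2 = a ^+ 2 + 1 by rewrite !sqr_sqrtr ?ler0n// -natr1.
rewrite -(ler_pM2r b0) mulrDl mulVf ?gt_eqF//.
have : 0 <= (a - b) ^+ 2 by exact: sqr_ge0.
rewrite !expr2 in bb *; nra.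
Qed.

Theorem theorem2 (R : realType) (d : nat) (N : 'rV[R]_d -> R)
    (Theta : set 'rV[R]_d) (psi : 'rV[R]_d -> R)
    (gpsi : 'rV[R]_d -> 'rV[R]_d) (sigma G M Dmax : R)
    (hN : is_norm N)
    (Theta_closed : closed Theta)
    (Theta_bounded : bounded_set Theta)
    (Theta_convex : convex_set Theta)
    (hsigma : 0 < sigma)
    (hpsi : C1_on Theta psi gpsi)
    (hsc : strongly_convex_on Theta N psi gpsi sigma)
    (hM : forall x, Theta x -> (dual_norm N (gpsi x) <= M%:E)%E)
    (hD : forall x y, Theta x -> Theta y -> bregman psi gpsi x y <= Dmax) :
  (forall (f : nat -> 'rV[R]_d -> R) (r : 'rV[R]_d -> R)
      (gf : nat -> 'rV[R]_d -> 'rV[R]_d) (gr : 'rV[R]_d -> 'rV[R]_d)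
      (Phi : nat -> 'rV[R]_d -> 'rV[R]_d) (T : nat) (eta : nat -> R)
      (hth tth th : nat -> 'rV[R]_d),
    (1 <= T)%N ->
    admissible_losses Theta N G f r gf gr ->
    (forall t, (1 <= t <= T)%N ->
       contractive_model Theta (bregman psi gpsi) (Phi t)) ->
    step_sizes eta ->
    dmd_iterates Theta psi gpsi r gf Phi eta T hth tth ->
    (forall t, (1 <= t <= T)%N -> Theta (th t)) ->
    regret f r T hth th <=
      Dmax / eta T.+1 + 2 * M / eta T * variation N Phi T th
      + G ^+ 2 / (2 * sigma) * \sum_(1 <= t < T.+1) eta t)
  /\
  (forall c : R, 0 < c -> exists2 C : R, 0 < C &
    forall (f : nat -> 'rV[R]_d -> R) (r : 'rV[R]_d -> R)
      (gf : nat -> 'rV[R]_d -> 'rV[R]_d) (gr : 'rV[R]_d -> 'rV[R]_d)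
      (Phi : nat -> 'rV[R]_d -> 'rV[R]_d) (T : nat) (eta : nat -> R)
      (hth tth th : nat -> 'rV[R]_d),
    (1 <= T)%N ->
    admissible_losses Theta N G f r gf gr ->
    (forall t, (1 <= t <= T)%N ->
       contractive_model Theta (bregman psi gpsi) (Phi t)) ->
    step_sizes eta ->
    (forall t, (1 <= t)%N -> eta t = c / Num.sqrt t%:R) \/
    (forall t, (1 <= t)%N -> eta t = c / Num.sqrt T%:R) ->
    dmd_iterates Theta psi gpsi r gf Phi eta T hth tth ->
    (forall t, (1 <= t <= T)%N -> Theta (th t)) ->
    regret f r T hth th <= C * Num.sqrt T%:R * (1 + variation N Phi T th)).
Proof.
split=> [f r gf gr Phi T eta hth tth th T1 hl hPhi heta hdmd hth_mem|c c0].
  exact: (dmd_regret_le hN Theta_convex hsigma hpsi hsc hM hD hl T1 hPhi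
    heta hdmd).
have A0 : 0 <= 2 * `|Dmax| / c by rewrite divr_ge0 ?mulr_ge0// ltW.
have B0 : 0 <= 2 * `|M| / c by rewrite divr_ge0 ?mulr_ge0// ltW.
have E0 : 0 <= G ^+ 2 * c / sigma.
  by apply: divr_ge0 (ltW hsigma); apply: mulr_ge0 (sqr_ge0 _) (ltW c0).
(* One summand for each term of the general bound, common to both step size schedules. Absolute
   values make the coefficients nonnegative, and [+ 1] makes [C] positive. *)
exists (2 * `|Dmax| / c + 2 * `|M| / c + G ^+ 2 * c / sigma + 1).
  by rewrite ltr_wpDl// !addr_ge0.
move=> f r gf gr Phi T eta hth tth th T1 hl hPhi heta etaE hdmd hth_mem.
have := dmd_regret_le hN Theta_convex hsigma hpsi hsc hM hD hl T1 hPhi heta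
  hdmd hth_mem.
have V0 : 0 <= variation N Phi T th.
  by rewrite sumr_ge0// => t _; exact: is_normr_ge0.
set V := variation _ _ _ _ in V0 *; set s : R := Num.sqrt T%:R.
have s0 : 0 < s by rewrite sqrtr_gt0 ltr0n.
(* Holds because [T.+1 <= 4 * T] for [1 <= T]. *)
have ss : Num.sqrt T.+1%:R <= 2 * s.
  have -> : 2 * s = Num.sqrt (4 * T%:R).
    by rewrite sqrtrM// (_ : 4 = 2 ^+ 2) ?sqrtr_sqr ?ger0_norm// -natrX.
  rewrite ler_wsqrtr// -natrM ler_nat (mulSn 3) -add1n addnC.
  by rewrite leq_add2l muln_gt0.
have eT : (eta T)^-1 = s / c.
  by case: etaE => -> //; rewrite invf_div.
have [eS _] := heta T.+1 isT.
have eTS : (eta T.+1)^-1 <= 2 * s / c.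
  case: etaE => -> //; rewrite invf_div -/s ler_pM2r ?invr_gt0//.
  by rewrite ler_peMl ?ltW// ltr1n.
have es : \sum_(1 <= t < T.+1) eta t <= 2 * c * s.
  case: etaE => etaE.
    rewrite big_nat_cond (eq_bigr (fun t => c * (Num.sqrt t%:R)^-1)).
      rewrite -big_nat_cond -mulr_sumr [2 * c]mulrC -mulrA ler_pM2l//.
      exact: sum_inv_sqrt_le.
    by move=> t /andP[/andP[t1 _] _]; rewrite etaE.
  rewrite big_nat_cond (eq_bigr (fun t : nat => c / s)); last first.
    by move=> t /andP[/andP[t1 _] _]; rewrite etaE.
  rewrite -big_nat_cond sumr_const_nat subn1 -[_ *+ _]mulr_natr.
  have -> : T.+1.-1%:R = s ^+ 2 :> R by rewrite sqr_sqrtr.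
  rewrite expr2 mulrA divfK ?gt_eqF//; have := mulr_gt0 c0 s0; lra.
move/le_trans; apply.
have h1 : Dmax / eta T.+1 <= 2 * `|Dmax| / c * s.
  apply: (@le_trans _ _ (`|Dmax| / eta T.+1)).
    by rewrite ler_wpM2r ?ler_norm// invr_ge0 ltW.
  have -> : 2 * `|Dmax| / c * s = `|Dmax| * (2 * s / c) by ring.
  by rewrite ler_wpM2l.
have h2 : 2 * M / eta T * V <= 2 * `|M| / c * s * V.
  rewrite ler_wpM2r// eT [s / c]mulrC mulrA !ler_pM2r ?invr_gt0//.
  by rewrite ler_pM2l// ler_norm.
have h3 : G ^+ 2 / (2 * sigma) * \sum_(1 <= t < T.+1) eta t <=
    G ^+ 2 * c / sigma * s.
  have -> : G ^+ 2 * c / sigma * s = G ^+ 2 / (2 * sigma) * (2 * c * s).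
    by field; rewrite gt_eqF.
  by rewrite ler_wpM2l// divr_ge0 ?sqr_ge0// mulr_ge0 ?ltW.
move: (2 * `|Dmax| / c) (2 * `|M| / c) (G ^+ 2 * c / sigma) A0 B0 E0 h1 h2 h3.
move=> A B E A0 B0 E0 h1 h2 h3.
(* These nonnegative products are the terms by which the expanded [(A + B + E + 1) * s * (1 + V)]
   exceeds [A * s + B * s * V + E * s], apart from [s] itself. *)
have := mulr_ge0 A0 (mulr_ge0 (ltW s0) V0).
have := mulr_ge0 E0 (mulr_ge0 (ltW s0) V0).
have := mulr_ge0 B0 (ltW s0); have := mulr_ge0 (ltW s0) V0.
lra.
Qed.
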